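(* Every graph of rankwidth $k$ has distance $2$VC-dimension at most $3\cdot 2^{k+1}+2$.
   Context: All graphs are finite and simple. For a graph $G=(V,E)$, $d_G(x,y)$ is the shortest-path distance ($+\infty$ if none) and $B_G(x,k)=\{y: d_G(x,y)\le k\}$. The $B$-hypergraph of $G$ has vertex set $V$ and hyperedges all balls $B_G(v,k)$, $v\in V$, $k\ge 0$ integer. A set $X$ of vertices is $2$-shattered by a hypergraph if for every $X'\subseteq X$ with $|X'|=2$ there is a hyperedge $e$ with $e\cap X=X'$; the $2$VC-dimension is the maximum size of a $2$-shattered set. The distance $2$VC-dimension of $G$ is the maximum over induced subgraphs $G'$ of $G$ of the $2$VC-dimension of the $B$-hypergraph of $G'$. Rankwidth: for a partition $(V_1,V_2)$ of $V$, the cutrank $cr(V_1,V_2)$ is the rank over $\mathbb{F}_2$ of the $|V_1|\times|V_2|$ matrix with entry $1$ at $(x_1,x_2)$ iff $x_1x_2\in E$. A ternary tree is a tree whose nodes have degree $1$ or $3$. A tree-representation of $G$ is a pair $(T,f)$ with $T$ a ternary tree with $|V|$ leaves and $f$ a bijection from $V$ to the leaves of $T$; each edge $e$ of $T$ induces a partition $(V_1^e,V_2^e)$ of $V$ via the two components of $T-e$. The rankwidth of $G$ is $\min_{(T,f)}\max_{e\in E(T)} cr(V_1^e,V_2^e)$. *)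

(* Defs.v *)
From HB Require Import structures.
From mathcomp Require Import all_boot all_order all_algebra.

Set Implicit Arguments.
Unset Strict Implicit.
Unset Printing Implicit Defensive.

Record sgraph := SGraph {
  vertex :> finType;
  edge : rel vertex;
  edge_sym : symmetric edge;
  edge_irrefl : irreflexive edge }.

Section InducedSubgraph.
Variables (G : sgraph) (A : {set G}).

Definition induced_edge : rel {x : G | x \in A} :=
  fun x y => edge (val x) (val y).

Lemma induced_edge_sym : symmetric induced_edge.
Proof. by move=> x y; apply: edge_sym. Qed.

Lemma induced_edge_irrefl : irreflexive induced_edge.
Proof. by move=> x; apply: edge_irrefl. Qed.

Definition induced : sgraph := SGraph induced_edge_sym induced_edge_irrefl.

End InducedSubgraph.

(** * Distance and balls *)

(* There is a path with [d] edges from [x] to [y]. *)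
Definition has_path (G : sgraph) (x y : G) (d : nat) : bool :=
  [exists p : d.-tuple G,
     [&& path (@edge G) x p, last x p == y & uniq (x :: p)]].

(* A path has fewer than #|G| edges, so the search below is exhaustive;
   [None] stands for an infinite distance. *)
Definition gdist (G : sgraph) (x y : G) : option nat :=
  let d := find (has_path x y) (iota 0 #|G|) in
  if d < #|G| then Some d else None.

Definition ball (G : sgraph) (x : G) (k : nat) : {set G} :=
  [set y | if gdist x y is Some d then d <= k else false].

(* Radii range over 'I_#|G| only to get a finite set of hyperedges; this loses
   no ball, see [B_hypergraphP]. *)
Definition B_hypergraph (G : sgraph) : {set {set G}} :=
  [set ball v k | v : G, k : 'I_#|G|].

Lemma B_hypergraphP (G : sgraph) (h : {set G}) :
  reflect (exists (v : G) (k : nat), h = ball v k) (h \in B_hypergraph G).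
Proof.
apply: (iffP imset2P) => [[v k _ _ ->]|[v [k ->]]]; first by exists v, k.
have G_gt0 : 0 < #|G| by apply/card_gt0P; exists v.
have lt_m : minn k #|G|.-1 < #|G|.
  by apply: leq_ltn_trans (geq_minr _ _) _; rewrite prednK.
exists v (Ordinal lt_m) => //.
apply/setP => y; rewrite !inE /gdist; case: ifP => //= ltd.
by rewrite leq_min -[X in _ && X]ltnS prednK // ltd andbT.
Qed.

(** * 2VC-dimension *)

Definition two_shattered (T : finType) (H : {set {set T}}) (X : {set T}) :
    bool :=
  [forall X' : {set T}, (X' \subset X) && (#|X'| == 2) ==>
     [exists h in H, h :&: X == X']].

Definition two_VCdim (T : finType) (H : {set {set T}}) : nat :=
  \max_(X : {set T} | two_shattered H X) #|X|.

Definition distance_two_VCdim (G : sgraph) : nat :=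
  \max_(A : {set G}) two_VCdim (B_hypergraph (induced A)).

(** * Rankwidth *)

Definition cutrank (G : sgraph) (V1 V2 : {set G}) : nat :=
  \rank (\matrix_(i < #|V1|, j < #|V2|)
           ((edge (enum_val i) (enum_val j))%:R : 'F_2))%R.

Definition degree (G : sgraph) (x : G) : nat := #|[set y | edge x y]|.

Definition is_tree (T : sgraph) : Prop :=
  [/\ 0 < #|T|,
      forall x y : T, connect (@edge T) x y &
      forall c : seq T, 2 < size c -> ~ ucycle (@edge T) c].

Definition ternary_tree (T : sgraph) : Prop :=
  is_tree T /\ forall x : T, degree x = 1 \/ degree x = 3.

Definition leaves (T : sgraph) : {set T} := [set x | degree x == 1].

Definition tree_representation (G T : sgraph) (f : G -> T) : Prop :=
  [/\ ternary_tree T, #|leaves T| = #|G|, injective f &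
      f @: [set: G] = leaves T].

Definition del_edge (T : sgraph) (a b : T) : rel T :=
  fun x y => edge x y && ((x, y) \notin [:: (a, b); (b, a)]).

(* For an edge ab of T, [side f a b] and [side f b a] are the two classes of
   the partition of the vertices of G induced by ab. *)
Definition side (G T : sgraph) (f : G -> T) (a b : T) : {set G} :=
  [set v | connect (del_edge a b) a (f v)].

Definition representation_width (G T : sgraph) (f : G -> T) : nat :=
  \max_(ab : T * T | edge ab.1 ab.2)
     cutrank (side f ab.1 ab.2) (side f ab.2 ab.1).

(* A ternary tree has at least two leaves, so graphs with at most one vertex
   have no tree-representation; their rankwidth is 0 by convention. *)
Definition has_rankwidth (G : sgraph) (k : nat) : Prop :=
  if #|G| <= 1 then k = 0
  else (exists (T : sgraph) (f : G -> T),
          tree_representation f /\ representation_width f = k) /\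
       (forall (T : sgraph) (f : G -> T),
          tree_representation f -> k <= representation_width f).

(* Main.v *)
Require Import Defs.
From HB Require Import structures.
From mathcomp Require Import all_boot all_order all_algebra.
From mathcomp Require Import zify.

(* Let X be 2-shattered by the balls of an induced subgraph H of G, and take an
   optimal tree-representation of G. If #|X| > 3 * 2 ^ k + 2, some edge of the
   tree splits G into V1 and V2 with more than 2 ^ k elements of X on each
   side. As the cut has rank at most k, the vertices of V1 fall into 2 ^ k
   classes with equal neighbourhoods in V2. Suppose that a ball centred in V1
   isolates a pair {x1, x2} of X with x1 in V1 and x2 in V2. A path realising
   d(z, x2) crosses from V1 to V2 at some u in V1; if another such path, for x2'
   and a center z', crosses at a vertex u' in the class of u, the tails of the
   two paths can be exchanged, so the shorter tail puts x2 in the ball of z' or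
   x2' in the ball of z. Hence x2 takes at most 2 ^ k values. By symmetry there
   are x1 in V1 and x2 in V2 such that no ball centred in V1 or V2 isolates
   {x1, x2}, a contradiction. *)

(** * Balls described by walks *)

(** Repeated vertices are allowed on [p], so a path obtained by exchanging tails can be used
    directly. Shortening it leaves fewer than [#|G|] edges, within the range searched by [gdist]. *)
Lemma mem_ballP (G : sgraph) (x y : G) (k : nat) :
  reflect (exists p : seq G, [/\ path (@edge G) x p, last x p = y & size p <= k])
          (y \in ball x k).
Proof.
have has_pathP d : reflect
    (exists p : seq G, [/\ path (@edge G) x p, last x p = y, uniq (x :: p) & size p = d])
    (has_path x y d).
  apply: (iffP existsP) => [[p /and3P[xp /eqP <- Up]]|[p [xp <- Up szp]]].
    by exists p; rewrite size_tuple.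
  move/eqP: szp => szp; exists (Tuple szp) => /=; by rewrite xp eqxx.
rewrite inE /gdist; set d := find _ _.
apply: (iffP idP) => [|[p [xp lp szp]]].
  case: ifP => // ltd dk.
  have: has (has_path x y) (iota 0 #|G|) by rewrite has_find size_iota.
  move/(nth_find 0); rewrite -/d nth_iota // add0n => /has_pathP[p [xp lp _ szp]].
  by exists p; rewrite szp.
case/shortenP: xp lp => q xq Uq /(uniq_leq_size _) szq lq.
have ltq : size q < #|G| by rewrite (leq_trans _ (max_card (mem (x :: q)))) // (card_uniqP Uq).
have led : d <= size q.
  rewrite leqNgt; apply/negP => /(before_find 0).
  rewrite nth_iota // add0n => /negbT/negP[].
  by apply/has_pathP; exists q.
rewrite (leq_ltn_trans led ltq) (leq_trans led) // (leq_trans (szq _)) //.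
by case/andP: Uq.
Qed.

Lemma card_leq_inj_rel {T C : finType} (A : {set T}) (R : T -> C -> Prop) :
  (forall x, x \in A -> exists c, R x c) ->
  {in A &, forall x y c, R x c -> R y c -> x = y} -> #|A| <= #|C|.
Proof.
move=> totR injR; have [->|[a /totR[c0 _]]] := set_0Vmem A; first by rewrite cards0.
have [f fR] : exists f : T -> C, forall x, x \in A -> R x (f x).
  apply: (@fin_all_exists _ (fun=> C) (fun x c => x \in A -> R x c)) => x.
  (* Outside [A] the choice function takes the default value [c0]. *)
  by have [/totR[c ?]|_] := boolP (x \in A); [exists c | exists c0].
apply: (leq_card_in f) => x y Ax Ay fxy.
by apply: (injR x y Ax Ay (f x)); [apply: fR | rewrite fxy; apply: fR].
Qed.

Lemma path_crosses {T : eqType} {e : rel T} {P : pred T} {x : T} {p : seq T} :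
  path e x p -> P x -> ~~ P (last x p) ->
  exists p1 w p2, [/\ p = p1 ++ w :: p2, P (last x p1) & ~~ P w].
Proof.
elim: p x => [|w p IHp] x /=; first by move=> _ ->.
case/andP=> _ wp Px; have [Pw|nPw] := boolP (P w) => lp; last by exists [::], w, p.
by have [p1 [w' [p2 [-> Pl nPw']]]] := IHp _ wp Pw lp; exists (w :: p1), w', p2.
Qed.

(** * Pairs isolated across a cut *)

Definition isolated_across {G : sgraph} (P : pred G) (X : {set G}) : {set G} :=
  [set x2 in X | ~~ P x2 && [exists x1, exists z, exists r : 'I_#|G|,
     [&& P x1, P z & ball z r :&: X == [set x1; x2]]]].

Lemma card_isolated_across {G : sgraph} {C : finType} (P : pred G) (cls : G -> C)
    (X : {set G}) :
  (forall u u' w, P u -> P u' -> ~~ P w -> cls u = cls u' -> edge u w = edge u' w) ->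
  #|isolated_across P X| <= #|C|.
Proof.
move=> edge_cls.
(* [entry c w]: one can cross the cut from class [c] to [w]. [nearest x c]: some tail from an entry
   of [c] to [x] is such that no tail of at most its length reaches another far-side vertex of
   [X]. *)
pose entry c w := ~~ P w /\ exists u, [/\ P u, cls u = c & edge u w].
pose nearest x c := exists w p, [/\ entry c w, path (@edge G) w p, last w p = x &
  forall w' q, entry c w' -> path (@edge G) w' q -> size q <= size p ->
    last w' q \in X -> ~~ P (last w' q) -> last w' q = x].
apply: (@card_leq_inj_rel _ _ _ nearest) => [x|x y].
  rewrite !inE => /and3P[Xx nPx /existsP[x1 /existsP[z /existsP[r /and3P[Px1 Pz /eqP ballE]]]]].
  have /mem_ballP[p [zp lp szp]] : x \in ball z r.
    by move/setP/(_ x): ballE; rewrite !inE Xx eqxx orbT andbT.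
  rewrite -lp in nPx; have [p1 [w [p2 [def_p Pu nPw]]]] := path_crosses zp Pz nPx.
  move: zp lp szp; rewrite def_p cat_path last_cat size_cat /=.
  case/and3P=> zp1 uw wp2 lp2 szp.
  exists (cls (last z p1)), w, p2; split=> // [|w' q [nPw' [u' [Pu' cu' uw']]] w'q szq Xq nPq].
    by split=> //; exists (last z p1).
  (* The edge into [w'] from [u'] transfers to the last near-side vertex of the path to [x], so [q]
     can replace the tail [p2]. *)
  have : last w' q \in ball z r :&: X.
    rewrite inE Xq andbT; apply/mem_ballP; exists (p1 ++ w' :: q).
    rewrite cat_path last_cat size_cat /= zp1 w'q andbT; split=> //; last first.
      by rewrite (leq_trans _ szp) // leq_add2l ltnS.
    by rewrite (edge_cls _ u').
  rewrite ballE !inE => /orP[/eqP qx1|/eqP //].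
  by rewrite qx1 Px1 in nPq.
rewrite !inE => /and3P[Xx nPx _] /and3P[Xy nPy _] c.
move=> [w [p [ew wp lp minp]]] [w' [q [ew' wq lq minq]]].
(* The property of the longer tail is applied to the shorter one. *)
case: (leqP (size p) (size q)) => [le_pq|/ltnW le_qp].
  by rewrite -lp; apply: minq; rewrite ?lp.
by apply/esym; rewrite -lq; apply: minp; rewrite ?lq.
Qed.

(** A rank factorization writes each row of the adjacency matrix in a basis of the row space; the
    class of [u] is its coordinate vector. *)
Lemma cutrank_classes {G : sgraph} (V1 V2 : {set G}) :
  exists cls : G -> 'rV['F_2]_(cutrank V1 V2), forall u u' w,
    u \in V1 -> u' \in V1 -> w \in V2 -> cls u = cls u' -> edge u w = edge u' w.
Proof.
rewrite /cutrank; set M := (\matrix_(i, j) _)%R.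
have [V1_0|[x0 V1x0]] := set_0Vmem V1.
  by exists (fun=> 0%R) => u u' w V1u; move: (V1u); rewrite {1}V1_0 inE.
exists (fun u => row (enum_rank_in V1x0 u) (col_base M)) => u u' w V1u V1u' V2w eq_row.
have rowM i : row i M = (row i (col_base M) *m row_base M)%R.
  by rewrite -row_mul mulmx_base.
have /rowP/(_ (enum_rank_in V2w w)) : row (enum_rank_in V1x0 u) M = row (enum_rank_in V1x0 u') M.
  by rewrite !rowM eq_row.
by rewrite !mxE !enum_rankK_in //; do 2!case: edge.
Qed.

(** The cut lives in [G] and the balls in [induced A]; classes are pulled back along [val], which
    preserves adjacency. *)
Lemma card_isolated_across_cut {G : sgraph} (V1 : {set G}) {A : {set G}}
    (X : {set induced A}) :
  #|isolated_across [pred x : induced A | val x \in V1] X| <= 2 ^ cutrank V1 (~: V1).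
Proof.
have [cls clsE] := cutrank_classes V1 (~: V1).
have -> : 2 ^ cutrank V1 (~: V1) = #|'rV['F_2]_(cutrank V1 (~: V1))|.
  by rewrite card_mx card_Fp // mul1n.
apply: (card_isolated_across _ (fun u : induced A => cls (val u))) => u u' w /= V1u V1u' V2w.
by apply: clsE; rewrite ?inE.
Qed.

Lemma two_shattered_cut {G : sgraph} {V1 A : {set G}} {X : {set induced A}} {m : nat} :
  two_shattered (B_hypergraph (induced A)) X ->
  2 ^ cutrank V1 (~: V1) <= m -> 2 ^ cutrank (~: V1) V1 <= m ->
  m < #|[set x in X | val x \in V1]| -> #|[set x in X | val x \in ~: V1]| <= m.
Proof.
move=> /forallP shX le12 le21 gt1; rewrite leqNgt; apply/negP => gt2.
have outside (Y Z : {set induced A}) : #|Z| <= m -> m < #|Y| -> exists2 x, x \in Y & x \notin Z.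
  move=> leZ gtY; apply/subsetPn; apply/negP => /subset_leq_card.
  by rewrite leqNgt (leq_ltn_trans leZ gtY).
have le1 := leq_trans (card_isolated_across_cut V1 X) le12.
have le2 := card_isolated_across_cut (~: V1) X; rewrite setCK in le2.
have [x2] := outside _ _ le1 gt2; have [x1] := outside _ _ (leq_trans le2 le21) gt1.
rewrite !inE => /andP[Xx1 V1x1] + /andP[Xx2 V2x2]; rewrite Xx1 Xx2 V1x1 V2x2 /= => iso1 iso2.
have neq12 : x1 != x2 by apply: contraNneq V2x2 => <-.
have := shX [set x1; x2]; rewrite cards2 neq12 eqxx andbT subUset !sub1set Xx1 Xx2 /=.
case/existsP=> h /andP[/imset2P[z r _ _ ->] /eqP ballE].
(* A centre in [V1] contradicts the choice of [x2], any other centre that of [x1]. *)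
have [V1z|V2z] := boolP (val z \in V1).
  case/negP: iso2; apply/existsP; exists x1; apply/existsP; exists z; apply/existsP; exists r.
  by rewrite V1x1 V1z ballE eqxx.
case/negP: iso1; apply/existsP; exists x2; apply/existsP; exists z; apply/existsP; exists r.
by rewrite !inE V2x2 V2z ballE setUC eqxx.
Qed.

(** * Splitting a ternary tree at an edge *)

Definition half {T : sgraph} (a b : T) : {set T} := [set t | connect (del_edge a b) a t].

Lemma del_edgeC {T : sgraph} (a b : T) : del_edge a b =2 del_edge b a.
Proof. by move=> x y; rewrite /del_edge !inE orbC. Qed.

Lemma del_edge_sym {T : sgraph} (a b : T) : symmetric (del_edge a b).
Proof.
move=> x y; rewrite /del_edge edge_sym !inE !xpair_eqE; congr (_ && ~~ _).
by rewrite orbC; congr (_ || _); rewrite andbC.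
Qed.

Section Tree.
Variable T : sgraph.
Hypothesis treeT : is_tree T.

(** Along a path from [a], a step through the deleted edge ends at [a] or [b], each in its own half;
    any other step stays in the same half. *)
Lemma half_cover (a b t : T) : (t \in half a b) || (t \in half b a).
Proof.
have extend p x : path (@edge T) x p -> x \in half a b :|: half b a ->
    last x p \in half a b :|: half b a.
  elim: p x => //= y p IHp x /andP[xy /IHp] + xab; apply.
  have [|keep] := boolP ((x, y) \in [:: (a, b); (b, a)]).
    by rewrite !inE => /orP[] /eqP[_ ->]; rewrite connect0 ?orbT.
  case/setUP: xab; rewrite !inE => xab; apply/orP; [left | right];
    apply: connect_trans xab (connect1 _); first by rewrite /del_edge xy.
  by rewrite del_edgeC /del_edge xy.
case: treeT => _ /(_ a t)/connectP[p ap ->] _.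
by rewrite -in_setU extend // !inE connect0.
Qed.

Lemma half_neq {a b t : T} : edge a b -> t \in half a b -> t != b.
Proof.
move=> ab; apply: contraTneq => ->; rewrite inE; apply/negP => /connectP[p0 ap0 lp0].
case/shortenP: ap0 lp0 => p ap Up _ lp.
have [_ _ /(_ (a :: p))] := treeT; case=> /=.
  (* An empty path would make [ab] a loop, a single edge would be the deleted one, and a longer path
     closes up with [ab] into a cycle. *)
  case: p ap Up lp => [|c [|d p]] //= ap Up lp; first by move: ab; rewrite lp edge_irrefl.
  by move: ap; rewrite -lp /del_edge !inE eqxx !andbF.
rewrite /ucycle Up andbT /= rcons_path -lp edge_sym ab andbT.
by apply: sub_path ap => x y /andP[].
Qed.

Lemma half_disjoint (a b t : T) : edge a b -> t \in half a b -> t \notin half b a.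
Proof.
move=> ab; rewrite !inE => at_; apply/negP => bt.
have /half_neq : b \in half a b; last by move/(_ ab); rewrite eqxx.
rewrite inE; apply: connect_trans at_ _.
by rewrite (sym_connect_sym (del_edge_sym a b)) (eq_connect (del_edgeC a b)).
Qed.

(** On a duplicate-free path from [b], everything after the first step avoids [b], hence the edge
    [bc]. *)
Lemma half_step {a b t : T} :
  t \in half b a -> t != b -> exists c, [/\ edge b c, c != a & t \in half c b].
Proof.
rewrite inE => /connectP[p0 bp0 ->]; case/shortenP: bp0 => -[|c p] /=; first by rewrite eqxx.
case/andP=> /andP[bc keep] cp /andP[nb_cp _] _ _; exists c; split=> //.
  by apply: contraNneq keep => ->; rewrite inE eqxx.
rewrite inE; apply/connectP; exists p => //.
apply: (@sub_in_path _ (predC1 b) _ _ _ c p) cp => [x y nxb nyb /andP[xy _]|].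
  by rewrite /del_edge xy !inE !xpair_eqE (negPf nxb) (negPf nyb) andbF.
by apply/allP => x x_cp; apply: contraNneq nb_cp => <-.
Qed.

(** Paths from [c] inside [half c b] avoid [b], so they survive the deletion of [ab]; the vertex [b]
    itself makes the inclusion strict. *)
Lemma half_proper {a b c : T} : edge b c -> c != a -> half c b \proper half b a.
Proof.
move=> bc nca; have cb : edge c b by rewrite edge_sym.
apply/properP; split; last first.
  by exists b; [rewrite inE connect0 | apply/negP => /(half_neq cb); rewrite eqxx].
apply/subsetP => t ct; move: (ct); rewrite inE => /connectP[p cp lp].
have nb x : x \in c :: p -> x != b.
  by move=> x_cp; apply: half_neq cb _; rewrite inE (path_connect cp).
rewrite inE; apply/connectP; exists (c :: p) => //=; apply/andP; split.
  by rewrite /del_edge bc !inE !xpair_eqE (negPf nca) (negPf (nb c (mem_head _ _))) !andbF.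
apply: (@sub_in_path _ (predC1 b) _ _ _ c p) cp => [x y nxb nyb /andP[xy _]|].
  by rewrite /del_edge xy !inE !xpair_eqE (negPf nxb) (negPf nyb) andbF.
exact/allP.
Qed.

Hypothesis degT : forall x : T, degree x = 1 \/ degree x = 3.

(** Apart from [a], the vertex [b] has at most two neighbours, each contributing at most [m]; the
    extra 1 is for [b] itself. *)
Lemma card_half_le (L : {set T}) (m : nat) {a b : T} :
  edge a b -> (forall c, edge b c -> c != a -> #|L :&: half c b| <= m) ->
  #|L :&: half b a| <= 2 * m + 1.
Proof.
move=> ab small; pose N := [set c | edge b c] :\ a.
have N_le2 : #|N| <= 2.
  have := cardsD1 a [set c | edge b c]; rewrite inE edge_sym ab -/N.
  by case: (degT b); rewrite /degree => ->; lia.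
have sub : L :&: half b a \subset b |: \bigcup_(c in N) (L :&: half c b).
  apply/subsetP => t /setIP[Lt /half_step tb]; rewrite in_setU1.
  have [//|/tb[c [bc nca tc]]] := eqVneq t b.
  by apply/bigcupP; exists c; [rewrite !inE nca | rewrite inE Lt].
apply: leq_trans (subset_leq_card sub) _; rewrite cardsU1 addnC leq_add ?leq_b1 //.
apply: (@leq_trans (\sum_(c in N) m)); last by rewrite sum_nat_const leq_mul2r N_le2 orbT.
apply: (@leq_trans (\sum_(c in N) #|L :&: half c b|)); last first.
  by apply: leq_sum => c; rewrite !inE => /andP[? ?]; apply: small.
elim/big_rec2: _ => [|c n S _ le_Sn]; first by rewrite cards0.
by apply: leq_trans (leq_card_setU _ _) _; rewrite leq_add2l.
Qed.

(** Starting from an edge with a light half behind it, move to a heavy half ahead until the half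
    left behind is heavy too; the half ahead shrinks strictly. *)
Lemma balanced_edge (L : {set T}) (m : nat) :
  3 * m + 2 <= #|L| ->
  exists a b : T, [/\ edge a b, m < #|L :&: half a b| & m < #|L :&: half b a|].
Proof.
move=> large.
have cover a b : #|L| <= #|L :&: half a b| + #|L :&: half b a|.
  apply: leq_trans (leq_card_setU _ _); apply/subset_leq_card/subsetP => t Lt.
  by have := half_cover a b t; rewrite !inE Lt.
have from_light n (a b : T) : edge a b -> #|half b a| <= n -> #|L :&: half a b| <= m ->
    exists a b : T, [/\ edge a b, m < #|L :&: half a b| & m < #|L :&: half b a|].
  elim: n a b => [|n IHn] a b ab size_ba light.
    by move: size_ba; rewrite leqn0 cards_eq0 => /eqP/setP/(_ b); rewrite !inE connect0.
  have [/existsP[c /and3P[bc nca heavy]]|none] :=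
    boolP [exists c, [&& edge b c, c != a & m < #|L :&: half c b|]].
    have [light'|heavy'] := leqP #|L :&: half b c| m; last by exists b, c.
    apply: (IHn b c) => //; rewrite -ltnS (leq_trans _ size_ba) //.
    exact/proper_card/half_proper.
  (* With no heavy branch ahead, [L] would have at most [m + (2 * m + 1)] elements, one too few. *)
  have := card_half_le L m ab; have := cover a b.
  suff small c : edge b c -> c != a -> #|L :&: half c b| <= m by move=> ? /(_ small); lia.
  move=> bc nca; rewrite leqNgt; apply: contraNN none => heavy.
  by apply/existsP; exists c; rewrite bc nca.
case: treeT => /card_gt0P[a _] _ _.
have [b ab] : exists b, edge a b.
  have /card_gt0P[b] : 0 < degree a by case: (degT a) => ->.
  by rewrite inE; exists b.
have [light|heavy] := leqP #|L :&: half a b| m; first exact: from_light ab (leqnn _) light.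
have [light|heavy'] := leqP #|L :&: half b a| m; last by exists a, b.
by apply: from_light (leqnn _) light; rewrite edge_sym.
Qed.

End Tree.

(** * From a balanced edge to the bound *)

Theorem theorem7 (G : sgraph) (k : nat) (hk : has_rankwidth G k) :
  distance_two_VCdim G <= 3 * 2 ^ k.+1 + 2.
Proof.
apply/bigmax_leqP => A _; apply/bigmax_leqP => X shX.
move: hk; rewrite /has_rankwidth; case: ifP => [G_le1 _|_ [[T [f [rep width]]] _]].
  have leX : #|X| <= #|G|.
    by apply: leq_trans (max_card _) _; apply: (leq_card val); apply: val_inj.
  by rewrite (leq_trans leX) // (leq_trans G_le1) // addn2.
have [[treeT degT] _ f_inj _] := rep.
pose L := [set f (val x) | x in X].
have fval_inj : injective (fun x : induced A => f (val x)).
  by move=> x y /f_inj/val_inj.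
have cardL a b : #|L :&: half a b| = #|[set x in X | val x \in side f a b]|.
  rewrite -(card_imset _ fval_inj); apply: eq_card => t; rewrite inE.
  apply/andP/imsetP => [[/imsetP[x Xx ->] abx]|[x]].
    by exists x => //; move: abx; rewrite !inE Xx.
  by rewrite !inE => /andP[Xx abx] ->; split=> //; apply: imset_f.
(* The argument gives the bound with [2 ^ k] in place of [2 ^ k.+1]. *)
suff small : #|X| <= 3 * 2 ^ k + 2.
  by rewrite (leq_trans small) // leq_add2r leq_mul2l leq_exp2l // leqnSn orbT.
rewrite leqNgt; apply/negP => /ltnW large.
have [|a [b [ab heavy_a heavy_b]]] := balanced_edge T treeT degT L (2 ^ k).
  by rewrite card_imset.
have sideC : side f b a = ~: side f a b.
  apply/setP => v; rewrite !inE.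
  have := half_cover T treeT a b (f v); have := half_disjoint T treeT a b (f v) ab.
  by rewrite !inE; do 2!case: connect => //= => /(_ isT).
have width_le x y : edge x y -> 2 ^ cutrank (side f x y) (side f y x) <= 2 ^ k.
  move=> xy; rewrite leq_exp2l // -width.
  exact: (@leq_bigmax_cond _ (fun ab : T * T => edge ab.1 ab.2)
           (fun ab => cutrank (side f ab.1 ab.2) (side f ab.2 ab.1)) (x, y)).
(* Taking the edge in both orientations bounds the cut rank in both orders of the two sides. *)
have := width_le a b ab; have := width_le b a; rewrite edge_sym => /(_ ab).
move: heavy_a heavy_b; rewrite !cardL sideC => heavy_a heavy_b le_ba le_ab.
by move: heavy_b; rewrite ltnNge (two_shattered_cut shX le_ab le_ba heavy_a).
Qed.
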